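(* Let $\mathcal{H}$ be a real Hilbert space, let $\widehat{T}:\mathcal{H}\rightsquigarrow\mathcal{H}$ be a maximal monotone set-valued operator, and assume that its zero set $S=\{u\in\mathcal{H}\mid 0\in\widehat{T}(u)\}$ is nonempty. Let $r>0$, let $u^{-1},u^{0}\in\mathcal{H}$ be given, and let $\{u^{k}\}_{k=0}^{\infty}$ be the sequence generated by $$\hat{u}^{k}=u^{k}+\theta_{k}(u^{k}-u^{k-1}),\qquad u^{k+1}=\alpha_{k}u^{0}+(1-\alpha_{k})\Big[(1-\beta_{k})\hat{u}^{k}+\beta_{k}J_{r^{-1}}^{\widehat{T}}(\hat{u}^{k}-r^{-1}e^{k})\Big],\qquad k=0,1,2,\ldots$$ Suppose that the following conditions hold: (1) $\{\alpha_{k}\}_{k=0}^{\infty}\subseteq(0,1)$ satisfies $\lim_{k\to\infty}\alpha_{k}=0$ and $\sum_{k=0}^{\infty}\alpha_{k}=\infty$; (2) $\{\beta_{k}\}_{k=0}^{\infty}\subseteq(0,2)$ satisfies $0<\liminf_{k\to\infty}\beta_{k}\leq\limsup_{k\to\infty}\beta_{k}<2$; (3) $\{\theta_{k}\}_{k=0}^{\infty}\subseteq[0,1)$ satisfies $\sum_{k=0}^{\infty}\frac{\theta_{k}}{\alpha_{k}}\|u^{k}-u^{k-1}\|_{\mathcal{H}}<\infty$; (4) $\{e^{k}\}_{k=0}^{\infty}\subset\mathcal{H}$ satisfies $\sum_{k=0}^{\infty}\|e^{k}\|_{\mathcal{H}}<\infty$. Then $\{u^{k}\}_{k=0}^{\infty}$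 converges strongly (i.e. in norm) to $u^{\ast}=\Pi_{S}(u^{0})$.
   Context: A set-valued map $T:\mathcal{H}\rightsquigarrow\mathcal{H}$ is monotone if $\langle\xi-\zeta,u-v\rangle_{\mathcal{H}}\geq 0$ for all $(u,\xi),(v,\zeta)$ in its graph $\{(u,\xi)\mid \xi\in T(u)\}$; it is maximal monotone if it is monotone and no monotone set-valued map has a graph strictly containing the graph of $T$. For a maximal monotone $T$ and a parameter $\rho>0$, the resolvent is $J_{\rho}^{T}(u)=(I+\rho T)^{-1}(u)$, which is a single-valued map defined on all of $\mathcal{H}$. The zero set of a maximal monotone operator is closed and convex, and for a nonempty closed convex set $S\subseteq\mathcal{H}$, $\Pi_{S}(u)$ denotes the metric projection of $u$ onto $S$ (the unique nearest point of $S$ to $u$). The parameters $\theta_k$ may depend on the iterates $u^{k},u^{k-1}$. *)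

(* Defs.v *)
From HB Require Import structures.
From mathcomp Require Export all_boot all_order all_algebra.
From mathcomp Require Export all_classical all_reals all_analysis.

Set Implicit Arguments.
Unset Strict Implicit.
Unset Printing Implicit Defensive.

Export Order.TTheory GRing.Theory Num.Theory.
Export numFieldNormedType.Exports.

Local Open Scope classical_set_scope.
Local Open Scope ring_scope.

(* A real Hilbert space is a complete normed module [H] together with an inner
   product [dot : {dot H for idfun}] (bilinear, symmetric, positive definite)
   that induces the norm of [H]. *)
Definition induces_norm (R : realType) (H : completeNormedModType R)
    (dot : {dot H for idfun}) : Prop :=
  forall u : H, `|u| ^+ 2 = dot u u.

Definition graph (U V : Type) (T : U -> set V) : set (U * V) :=
  [set p | T p.1 p.2].

Definition monotone (R : realType) (H : completeNormedModType R)
    (dot : {dot H for idfun}) (T : H -> set H) : Prop :=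
  forall u v xi zeta : H, graph T (u, xi) -> graph T (v, zeta) ->
    0 <= dot (xi - zeta) (u - v).

Definition maximal_monotone (R : realType) (H : completeNormedModType R)
    (dot : {dot H for idfun}) (T : H -> set H) : Prop :=
  monotone dot T /\
  ~ exists T' : H -> set H, monotone dot T' /\ graph T `<` graph T'.

Definition zeros (R : realType) (H : completeNormedModType R)
    (T : H -> set H) : set H :=
  [set u | T u 0].

(* The set (I + rho T)^{-1}(u) of all v with u \in v + rho T(v). *)
Definition resolvent_set (R : realType) (H : completeNormedModType R)
    (rho : R) (T : H -> set H) (u : H) : set H :=
  [set v | exists2 xi, T v xi & u = v + rho *: xi].

(* [get] picks an element; [resolvent_set] is a singleton when T is maximal
   monotone and rho > 0. *)
Definition resolvent (R : realType) (H : completeNormedModType R)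
    (rho : R) (T : H -> set H) (u : H) : H :=
  get (resolvent_set rho T u).

Definition nearest_points (R : realType) (H : completeNormedModType R)
    (S : set H) (u : H) : set H :=
  [set v | S v /\ forall w, S w -> `|u - v| <= `|u - w|].

(* [nearest_points] is a singleton when S is nonempty, closed and convex and
   the norm of H comes from an inner product. *)
Definition metric_proj (R : realType) (H : completeNormedModType R)
    (S : set H) (u : H) : H :=
  get (nearest_points S u).

(* u^{k-1}, where the sequence u starts at index 0 and um1 is u^{-1}. *)
Definition prev (V : Type) (um1 : V) (u : nat -> V) (k : nat) : V :=
  if k is j.+1 then u j else um1.

(* Main.v *)
Require Import Defs.
From mathcomp Require Import ring lra.

Set Implicit Arguments.
Unset Strict Implicit.
Unset Printing Implicit Defensive.

Local Open Scope classical_set_scope.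
Local Open Scope ring_scope.

(** The proof compares the sequence with the exact Halpern iteration
    v_{k+1} = alpha_k u^0 + (1 - alpha_k) G_k v_k, where
    G_k = (1 - beta_k) I + beta_k J is the relaxed resolvent. Each G_k is
    nonexpansive, so the inertial term and the error e^k move one step by at
    most theta_k |u^k - u^{k-1}| + 2 |e^k| / r. This is summable because
    alpha_k < 1, and a summable perturbation is forgotten by the factors
    1 - alpha_k, whose product is zero ([halpern_recurrence_cvg0],
    [halpern_perturbed]).

    For the exact iteration, with residual s_k = |v_k - J v_k| and p the
    projection of u^0 on the zero set, one step gives
    |v_{k+1} - p|^2 <= (1 - alpha_k) (|v_k - p|^2 - c s_k^2)
                       + 2 alpha_k <u^0 - p, v_{k+1} - p>
    with c > 0 provided by the bounds on beta_k. For every eps > 0 the inner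
    product is at most eps + C (s_k + alpha_k), by a quantitative form of
    demiclosedness ([resolvent_path_limit_variational]); the quadratic gain
    absorbs the linear term C s_k, and the same scalar recurrence gives v_k --> p
    ([halpern_step], [halpern_cvg]).

    The projection p is constructed as the limit of the resolvents of
    parameter n + 1 at u^0 ([resolvent_path_cvg]). Monotonicity makes their
    distances to u^0 increase, and the increments dominate the squared displacements, so the
    path is Cauchy. The monotonicity inequality at a nearby point of the path
    also yields the demiclosedness estimate, hence the obtuse angle condition
    that identifies p with the metric projection ([metric_proj_obtuse]).

    All this uses that resolvents are defined everywhere, which is the theorem of
    Minty ([minty]). It is obtained by minimising F + |.|^2 / 2 over H x H, where
    F is the Fitzpatrick function of the operator; strong convexity makes
    minimising sequences converge in norm, and the optimality condition together
    with maximality places the minimiser, up to sign, on the graph ([minty0]). *)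

(** * Inner products inducing the norm *)

Section InnerProduct.
Variables (R : realType) (H : completeNormedModType R).
Variable dot : {dot H for idfun}.
Hypothesis dot_norm : induces_norm dot.
Implicit Types x y z : H.

Lemma dotC x y : dot x y = dot y x.
Proof. by have := @hermitian_subproof _ _ _ _ dot x y; rewrite /= expr0 mul1r. Qed.

Lemma dotDl x y z : dot (x + y) z = dot x z + dot y z.
Proof. exact: linearDl. Qed.

Lemma dotDr x y z : dot z (x + y) = dot z x + dot z y.
Proof. exact: linearDr. Qed.

Lemma dotNl x z : dot (- x) z = - dot x z.
Proof. exact: linearNl. Qed.

Lemma dotNr x z : dot z (- x) = - dot z x.
Proof. exact: linearNr. Qed.

Lemma dotZl a x z : dot (a *: x) z = a * dot x z.
Proof. exact: linearZl_LR. Qed.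

Lemma dotZr a x z : dot z (a *: x) = a * dot z x.
Proof. exact: linearZr_LR. Qed.

Definition dotE := (dotDl, dotDr, dotNl, dotNr, dotZl, dotZr).

Lemma dot_ge0 x : 0 <= dot x x.
Proof. by rewrite -dot_norm sqr_ge0. Qed.

Lemma dot0l x : dot 0 x = 0. Proof. exact: linear0l. Qed.

(** Cauchy-Schwarz, from the nonnegativity of the squared norm of the
    combination |y| x - |x| y. *)
Lemma ler_dot_norm x y : dot x y <= `|x| * `|y|.
Proof.
have [->|x0] := eqVneq x 0; first by rewrite dot0l normr0 mul0r.
have [->|y0] := eqVneq y 0; first by rewrite dotC dot0l normr0 mulr0.
have xy0 : 0 < `|x| * `|y| by rewrite mulr_gt0 ?normr_gt0.
have := dot_ge0 (`|y| *: x - `|x| *: y).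
rewrite !dotE (dotC y x) -!dot_norm => h.
by rewrite -(ler_pM2r xy0); nra.
Qed.

(** By polarization the inner product inherits continuity from the norm. *)
Lemma cvg_dot (f g : nat -> H) x y :
  f @ \oo --> x -> g @ \oo --> y -> (fun n => dot (f n) (g n)) @ \oo --> dot x y.
Proof.
have polar a b : dot a b = (`|a + b| ^+ 2 - `|a - b| ^+ 2) / 4.
  by rewrite !dot_norm !dotE (dotC b a); field.
move=> fx gy; rewrite polar.
under eq_fun do rewrite polar.
apply: cvgMl; apply: cvgB; rewrite expr2.
  under eq_fun do rewrite expr2.
  by apply: cvgM; apply: cvg_norm; apply: cvgD.
under eq_fun do rewrite expr2.
by apply: cvgM; apply: cvg_norm; apply: cvgB.
Qed.

End InnerProduct.

Arguments dotC {R H dot} x y.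

(** * Passing to the limit *)

Section Limits.
Variables (R : realType) (H : completeNormedModType R).

Lemma convex_subr (V : lmodType R) (a : R) (x y z : V) :
  a *: x + (1 - a) *: y - z = a *: (x - z) + (1 - a) *: (y - z).
Proof.
rewrite !scalerBr [RHS]addrACA -opprD -scalerDl.
by rewrite (_ : a + (1 - a) = 1) ?scale1r//; ring.
Qed.

Lemma ler_cvgn (f g : nat -> R) (a b : R) :
  f @ \oo --> a -> g @ \oo --> b -> (\forall n \near \oo, f n <= g n) -> a <= b.
Proof.
move=> fa gb fg; rewrite -(cvg_lim _ fa)// -(cvg_lim _ gb)//.
by apply: ler_lim => //; [exact: cvgP fa|exact: cvgP gb].
Qed.

(** The form in which completeness is used: both the minimising sequences and
    the resolvent path below satisfy such a squared estimate, where [b] measures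
    how far a monotone or minimised quantity is from its limit. *)
Lemma cauchy_sqr_cvgn (x : nat -> H) (b : nat -> R) :
  b @ \oo --> 0 -> (forall m n, `|x m - x n| ^+ 2 <= b m + b n) -> cvgn x.
Proof.
move=> b0 xb; apply/cauchy_cvgP/cauchy_ballP => e e0; near_simpl.
have e20 : 0 < e ^+ 2 / 2 by rewrite divr_gt0 ?exprn_gt0.
have /cvgrPdist_lt/(_ _ e20) hb := b0.
near=> p.
have h1 : `|0 - b p.1| < e ^+ 2 / 2.
  by near: p; exact: (cvg_fst hb).
have h2 : `|0 - b p.2| < e ^+ 2 / 2.
  by near: p; exact: (cvg_snd hb).
rewrite -ball_normE /ball_ /= -(ltr_pXn2r (n := 2)) ?nnegrE ?normr_ge0 ?(ltW e0)//.
apply: (le_lt_trans (xb _ _)).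
move: h1 h2; rewrite !sub0r !normrN !ltr_norml => /andP[_ h1] /andP[_ h2].
lra.
Unshelve. all: by end_near.
Qed.

End Limits.

(** * Surjectivity of I + T by minimising over the Fitzpatrick epigraph *)

Section Minty.
Variables (R : realType) (H : completeNormedModType R).
Variable dot : {dot H for idfun}.
Hypothesis dot_norm : induces_norm dot.

Definition monotonically_related (T : H -> set H) (x xi : H) :=
  forall y eta, T y eta -> 0 <= dot (xi - eta) (x - y).

Lemma maximal_monotone_dot T x xi y eta : maximal_monotone dot T ->
  T x xi -> T y eta -> 0 <= dot (xi - eta) (x - y).
Proof. by move=> [monT _] Tx Ty; exact: monT Tx Ty. Qed.

(** Maximality as it is used in practice: a pair that could be added to the
    graph of [T] without destroying monotonicity already lies in it. *)
Lemma maximal_monotone_related T x xi :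
  maximal_monotone dot T -> monotonically_related T x xi -> T x xi.
Proof.
move=> [monT maxT] rel; apply: contrapT => nTx; apply: maxT.
exists (fun u => T u `|` [set v | u = x /\ v = xi]); split.
  rewrite /monotone /graph /= => u v a b [Ta|[-> ->]] [Tb|[-> ->]].
  - exact: monT.
  - by have := rel _ _ Ta; rewrite -(opprB a xi) -(opprB u x) dotNl dotNr opprK.
  - exact: rel.
  - by rewrite !subrr dot0l.
split=> [[u v] /= Tuv|/(_ (x, xi))]; first by left.
by apply: contra_not nTx => h; apply: h; right.
Qed.

Variable T : H -> set H.
Hypothesis monT : monotone dot T.
Hypothesis maxT : forall x xi, monotonically_related T x xi -> T x xi.

(** The epigraph of the Fitzpatrick function of [T],
    F(x, xi) = sup over the graph of <x, eta> + <y, xi> - <y, eta>.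
    The epigraph stands in for F because F may take the value +oo. *)
Definition fitzpatrick_epi (x xi : H) (t : R) :=
  forall y eta, T y eta -> dot x eta + dot y xi - dot y eta <= t.

(** Minimising this over the epigraph minimises F + |.|^2 / 2, a strongly convex
    lower semicontinuous function on the product H x H. *)
Definition energy (x xi : H) (t : R) := t + (`|x| ^+ 2 + `|xi| ^+ 2) / 2.

Lemma graph_fitzpatrick_epi y eta : T y eta -> fitzpatrick_epi y eta (dot y eta).
Proof.
move=> Ty z zeta Tz; have := monT Ty Tz.
rewrite !dotE (dotC eta y) (dotC eta z) (dotC zeta y) (dotC zeta z).
by move=> h; lra.
Qed.

(** The property of the Fitzpatrick function that encodes maximality: a pair
    outside the graph is not monotonically related to some point of it, and that
    point makes the supremum exceed <x, xi>. *)
Lemma fitzpatrick_epi_ge_dot x xi t : fitzpatrick_epi x xi t -> dot x xi <= t.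
Proof.
move=> xt; have [Tx|nTx] := pselect (T x xi).
  by have := xt _ _ Tx; rewrite addrK.
rewrite leNgt; apply/negP => tx; apply: nTx; apply: maxT => y eta Ty.
have := xt _ _ Ty; rewrite !dotE (dotC xi) (dotC eta x) (dotC xi) (dotC eta y).
by move=> h; lra.
Qed.

Lemma energy_ge0 x xi t : fitzpatrick_epi x xi t -> 0 <= energy x xi t.
Proof.
move=> /fitzpatrick_epi_ge_dot xt; rewrite /energy !dot_norm.
have := dot_ge0 dot_norm (x + xi); rewrite !dotE (dotC xi x).
lra.
Qed.

Lemma fitzpatrick_epi_convex x xi t y eta s a : 0 <= a <= 1 ->
  fitzpatrick_epi x xi t -> fitzpatrick_epi y eta s ->
  fitzpatrick_epi (x + a *: (y - x)) (xi + a *: (eta - xi)) (t + a * (s - t)).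
Proof.
move=> /andP[a0 a1] xt ys z zeta Tz.
have := xt _ _ Tz; have := ys _ _ Tz; rewrite !dotE => h1 h2.
have {}h1 := ler_wpM2l a0 h1.
have a1' : 0 <= 1 - a by rewrite subr_ge0.
have {}h2 := ler_wpM2l a1' h2.
lra.
Qed.

(** The exact defect of convexity along a segment. At the midpoint it makes
    minimising sequences Cauchy; for small [a] it gives the first order
    optimality condition. *)
Lemma energyE x xi t y eta s a :
  energy (x + a *: (y - x)) (xi + a *: (eta - xi)) (t + a * (s - t)) =
  (1 - a) * energy x xi t + a * energy y eta s
  - a * (1 - a) / 2 * (`|x - y| ^+ 2 + `|xi - eta| ^+ 2).
Proof.
by rewrite /energy !dot_norm !dotE (dotC y x) (dotC eta xi); field.
Qed.

(** At midpoints the convexity defect bounds the squared distance between two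
    near-minimisers by the excess of their energies, so any minimising sequence
    converges in norm, and the limit stays in the closed epigraph. *)
Lemma energy_has_min : exists x xi t, fitzpatrick_epi x xi t /\
  forall y eta s, fitzpatrick_epi y eta s -> energy x xi t <= energy y eta s.
Proof.
pose E := [set e | exists x xi t, fitzpatrick_epi x xi t /\ e = energy x xi t].
have E0 : E !=set0.
  have [[y [eta Ty]]|noT] := pselect (exists y eta, T y eta).
    exists (energy y eta (dot y eta)), y, eta, (dot y eta); split=> //.
    exact: graph_fitzpatrick_epi.
  by exists (energy 0 0 0), 0, 0, 0; split=> // y eta Ty; case: noT; exists y, eta.
have lbE : lbound E 0 by move=> _ [x [xi [t [xt ->]]]]; exact: energy_ge0.
have infE x xi t : fitzpatrick_epi x xi t -> inf E <= energy x xi t.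
  by move=> xt; apply: ge_inf; [exists 0|exists x, xi, t].
have minimizing (n : nat) : exists p : H * H * R, fitzpatrick_epi p.1.1 p.1.2 p.2 /\
    energy p.1.1 p.1.2 p.2 < inf E + harmonic n.
  have hE : has_inf E by split=> //; exists 0.
  have [_ [x [xi [t [xt ->]]]] lte] := inf_adherent (harmonic_gt0 n) hE.
  by exists (x, xi, t).
have [p pE] := choice minimizing.
have dist m n : `|(p m).1.1 - (p n).1.1| ^+ 2 + `|(p m).1.2 - (p n).1.2| ^+ 2 <=
    4 * harmonic m + 4 * harmonic n.
  have [pm em] := pE m; have [pn en] := pE n.
  have half : 0 <= (2^-1 : R) <= 1 by apply/andP; split; lra.
  have := infE _ _ _ (fitzpatrick_epi_convex half pm pn).
  rewrite energyE; lra.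
have harm4 : (fun n => 4 * harmonic n : R) @ \oo --> 0.
  by rewrite -[X in _ --> X](mulr0 4); apply: cvgMr; exact: cvg_harmonic.
have /cvg_ex[x xP] : cvgn (fun n => (p n).1.1).
  apply: (cauchy_sqr_cvgn harm4) => m n; apply: le_trans (dist m n).
  by rewrite lerDl sqr_ge0.
have /cvg_ex[xi xiP] : cvgn (fun n => (p n).1.2).
  apply: (cauchy_sqr_cvgn harm4) => m n; apply: le_trans (dist m n).
  by rewrite lerDr sqr_ge0.
(* The third component of the minimising sequence needs no separate limit: it is
   determined by the infimum and the two others. *)
exists x, xi, (inf E - (`|x| ^+ 2 + `|xi| ^+ 2) / 2); split; last first.
  by move=> y eta s ys; rewrite {1}/energy subrK; exact: infE.
move=> y eta Ty.
have cvgr : (fun n => inf E + harmonic n) @ \oo --> inf E + 0.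
  by apply: cvgD; [exact: cvg_cst|exact: cvg_harmonic].
rewrite lerBrDr -[leRHS]addr0.
pose f n := dot (p n).1.1 eta + dot y (p n).1.2 - dot y eta +
  (`|(p n).1.1| ^+ 2 + `|(p n).1.2| ^+ 2) / 2.
apply: (ler_cvgn (f := f)) cvgr _; last first.
  apply: nearW => n; have [pn /ltW en] := pE n.
  by apply: le_trans en; rewrite /f lerD2r; exact: pn.
rewrite /f; under eq_fun do rewrite !dot_norm.
rewrite !dot_norm.
apply: cvgD; first apply: cvgB; first apply: cvgD.
- by apply: cvg_dot => //; exact: cvg_cst.
- by apply: cvg_dot => //; exact: cvg_cst.
- exact: cvg_cst.
- by apply: cvgMl; apply: cvgD; apply: cvg_dot.
Qed.

Lemma ler0_slope (A B : R) : 0 <= B ->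
  (forall a, 0 < a <= 1 -> 0 <= A + a * B) -> 0 <= A.
Proof.
move=> B0 h; rewrite leNgt; apply/negP => A0.
have BA : 0 < B - A by lra.
have : 0 < - A / (B - A) <= 1.
  by rewrite divr_gt0 ?oppr_gt0// ler_pdivrMr//=; lra.
move=> /h; rewrite (_ : A + _ = - (A ^+ 2 / (B - A))); last first.
  by field; rewrite gt_eqF.
rewrite oppr_ge0 leNgt divr_gt0 ?exprn_even_gt0//= lt_eqF//.
Qed.

(** The minimiser (x, xi) satisfies (-x, -xi) in the subdifferential of F there.
    Testing this at a point (y, eta) of the graph, where F(y, eta) = <y, eta>,
    shows that <eta + x, y + xi> >= |x + xi|^2. Hence (-xi, -x) is monotonically
    related to the graph, so it lies in it, and the inequality at that very
    point forces x + xi = 0. *)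
Lemma minty0 : exists x, T x (- x).
Proof.
have [x [xi [t [xt xmin]]]] := energy_has_min.
have xle := fitzpatrick_epi_ge_dot xt.
have key y eta : T y eta -> `|x + xi| ^+ 2 <= dot (- x - eta) (- xi - y).
  move=> Ty; have yt := graph_fitzpatrick_epi Ty.
  pose B := (`|x - y| ^+ 2 + `|xi - eta| ^+ 2) / 2.
  have : 0 <= energy y eta (dot y eta) - energy x xi t - B.
    apply: (@ler0_slope _ B).
      by rewrite divr_ge0 ?addr_ge0 ?sqr_ge0.
    move=> a /andP[a0 a1].
    have a01 : 0 <= a <= 1 by rewrite ltW.
    have := xmin _ _ _ (fitzpatrick_epi_convex a01 xt yt).
    rewrite energyE -(pmulr_rge0 _ a0) /B; lra.
  rewrite /B /energy !dot_norm !dotE.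
  rewrite (dotC y x) (dotC eta xi) (dotC eta y) (dotC xi x); lra.
have Tx : T (- xi) (- x).
  by apply: maxT => y eta /key; apply: le_trans; exact: sqr_ge0.
exists (- xi); rewrite opprK; have := key _ _ Tx.
rewrite subrr dot0l => le0.
have /eqP : `|x + xi| ^+ 2 = 0 by apply/le_anti; rewrite le0 sqr_ge0.
by rewrite sqrf_eq0 normr_eq0 addr_eq0 => /eqP xE; move: Tx; rewrite xE opprK.
Qed.

End Minty.

(** * Resolvents and their relaxations *)

Section Resolvent.
Variables (R : realType) (H : completeNormedModType R).
Variable dot : {dot H for idfun}.
Hypothesis dot_norm : induces_norm dot.
Variable T : H -> set H.
Hypothesis T_maxmon : maximal_monotone dot T.

(** Apply the case rho = 1, u = 0 to the operator x |-> rho T(x) - u, which is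
    again maximal monotone. *)
Lemma minty (rho : R) (u : H) : 0 < rho -> resolvent_set rho T u !=set0.
Proof.
move=> rho0; have rho_neq0 : rho != 0 by rewrite gt_eqF.
pose T' (x : H) : set H := [set xi | T x (rho^-1 *: (xi + u))].
have [||x Tx] := @minty0 _ _ _ dot_norm T'.
- move=> x y xi eta Txi Teta; have := maximal_monotone_dot T_maxmon Txi Teta.
  by rewrite -scalerBr opprD addrACA subrr addr0 dotZl pmulr_rge0 ?invr_gt0.
- move=> x xi rel; apply: (maximal_monotone_related T_maxmon) => y eta Ty.
  have : T' y (rho *: eta - u) by rewrite /T'/= subrK scalerA mulVf// scale1r.
  move=> /rel; rewrite -(pmulr_rge0 _ (_ : 0 < rho^-1)) ?invr_gt0//.
  by rewrite -dotZl opprB addrA scalerBr scalerA mulVf// scale1r.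
exists x; exists (rho^-1 *: (- x + u)) => //.
by rewrite scalerA divff// scale1r addNKr.
Qed.

Lemma resolvent_graph (rho : R) (u : H) : 0 < rho ->
  T (resolvent rho T u) (rho^-1 *: (u - resolvent rho T u)).
Proof.
move=> rho0; have [xi Txi {2}->] := getPex (minty u rho0).
by rewrite -/(resolvent rho T u) addrC addKr scalerA mulVf ?gt_eqF// scale1r.
Qed.

Variables (rho : R) (rho_gt0 : 0 < rho).
Local Notation J := (resolvent rho T).

Lemma resolvent_monotone u y xi : T y xi ->
  rho * dot xi (J u - y) <= dot (u - J u) (J u - y).
Proof.
move=> Ty; have := maximal_monotone_dot T_maxmon (resolvent_graph u rho_gt0) Ty.
rewrite dotDl dotNl dotZl => /(mulr_ge0 (ltW rho_gt0)).
by rewrite mulrBr mulrA divff ?gt_eqF// mul1r subr_ge0.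
Qed.

Lemma resolvent_firm x y : `|J x - J y| ^+ 2 <= dot (x - y) (J x - J y).
Proof.
have := resolvent_monotone x (resolvent_graph y rho_gt0).
rewrite dotZl mulrA divff ?gt_eqF// mul1r dot_norm !dotE (dotC (J y) (J x)).
lra.
Qed.

Lemma resolvent_nonexpansive x y : `|J x - J y| <= `|x - y|.
Proof.
rewrite -(@ler_pXn2r _ 2) ?nnegrE//.
have := resolvent_firm x y; have := dot_ge0 dot_norm ((x - y) - (J x - J y)).
move: (x - y) (J x - J y) => d j.
by rewrite !dot_norm !dotE (dotC j d); lra.
Qed.

Lemma resolvent_zero z : zeros T z -> J z = z.
Proof.
move=> Tz; have := resolvent_monotone z Tz.
rewrite dot0l mulr0 -(opprB z) dotNr -dot_norm oppr_ge0 => le0.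
have /eqP : `|z - J z| ^+ 2 = 0 by apply/le_anti; rewrite le0 sqr_ge0.
by rewrite sqrf_eq0 normr_eq0 subr_eq0 => /eqP <-.
Qed.

Definition relaxed_resolvent (b : R) (x : H) := (1 - b) *: x + b *: J x.

(** Firm nonexpansiveness makes 2J - I nonexpansive, so the relaxation is an
    average of the identity and a nonexpansive map when 0 <= b <= 2. The gain
    b (2 - b) |.|^2 is what later controls the residual v - J v. *)
Lemma relaxed_resolvent_averaged b x y : 0 <= b ->
  `|relaxed_resolvent b x - relaxed_resolvent b y| ^+ 2 <=
  `|x - y| ^+ 2 - b * (2 - b) * `|(x - J x) - (y - J y)| ^+ 2.
Proof.
move=> b0; rewrite /relaxed_resolvent.
have -> : (1 - b) *: x + b *: J x - ((1 - b) *: y + b *: J y) =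
    (1 - b) *: (x - y) + b *: (J x - J y).
  by rewrite !scalerBr opprD addrACA.
have -> : x - J x - (y - J y) = (x - y) - (J x - J y) 
    by rewrite !opprB [LHS]addrACA [RHS]addrACA (addrC (- J x)).
have := ler_wpM2l b0 (resolvent_firm x y).
move: (x - y) (J x - J y) => d j; rewrite !dot_norm !dotE (dotC j d); lra.
Qed.

Lemma relaxed_resolvent_nonexpansive b x y : 0 <= b <= 2 ->
  `|relaxed_resolvent b x - relaxed_resolvent b y| <= `|x - y|.
Proof.
move=> /andP[b0 b2]; rewrite -(@ler_pXn2r _ 2) ?nnegrE//.
apply: le_trans (relaxed_resolvent_averaged x y b0) _.
by rewrite gerBl !mulr_ge0 ?sqr_ge0 ?subr_ge0.
Qed.

End Resolvent.

(** * The resolvent path from u towards the nearest zero *)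

Section ResolventPath.
Variables (R : realType) (H : completeNormedModType R).
Variable dot : {dot H for idfun}.
Hypothesis dot_norm : induces_norm dot.
Variable T : H -> set H.
Hypothesis T_maxmon : maximal_monotone dot T.
Hypothesis zerosT : zeros T !=set0.
Variable u : H.

Local Notation path n := (resolvent n.+1%:R T u).

(** For m < n, with t > 1 the ratio of the parameters, monotonicity between the
    points x_m and x_n reads
    (t - 1) <u - x_m, x_n - x_m> <= - |x_n - x_m|^2, so this inner product is
    nonpositive and the triangle u, x_m, x_n is obtuse at x_m. *)
Lemma resolvent_path_gap m n : (m <= n)%N ->
  `|path m - path n| ^+ 2 <= `|u - path n| ^+ 2 - `|u - path m| ^+ 2.
Proof.
rewrite leq_eqVlt => /predU1P[->|mn].
  by rewrite !subrr normr0 expr0n.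
have m0 : 0 < m.+1%:R :> R by rewrite ltr0n.
have n0 : 0 < n.+1%:R :> R by rewrite ltr0n.
have := resolvent_monotone dot_norm T_maxmon n0 u
  (resolvent_graph dot_norm T_maxmon u m0).
have : 1 < n.+1%:R / m.+1%:R :> R by rewrite ltr_pdivlMr// mul1r ltr_nat.
rewrite dotZl mulrA; move: (_ / _) (path m) (path n) => t xm xn t1.
have := dot_ge0 dot_norm (xn - xm).
set P := dot (u - xm) (xn - xm).
have -> : dot (u - xn) (xn - xm) = P - dot (xn - xm) (xn - xm).
  by rewrite /P !dotE; ring.
move=> D0 tP; have P0 : P <= 0.
  rewrite -(pmulr_rle0 _ (_ : 0 < t - 1)) ?subr_gt0//; lra.
move: P0; rewrite /P !dot_norm !dotE.
rewrite (dotC xm u) (dotC xn u) (dotC xn xm); lra.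
Qed.

Lemma resolvent_path_bounded z n : zeros T z -> `|u - path n| ^+ 2 <= `|u - z| ^+ 2.
Proof.
move=> Tz; have n0 : 0 < n.+1%:R :> R by rewrite ltr0n.
have := resolvent_monotone dot_norm T_maxmon n0 u Tz.
rewrite dot0l mulr0; have := dot_ge0 dot_norm (path n - z).
move: (path n) => x; rewrite !dot_norm !dotE.
rewrite (dotC z x) (dotC z u) (dotC x u); lra.
Qed.

(** The distances to [u] increase and are bounded by the distance to any zero,
    so the gap estimate makes the path Cauchy. *)
Lemma resolvent_path_cvg : exists p : H, (fun n => path n) @ \oo --> p.
Proof.
have [z Tz] := zerosT.
pose a n := `|u - path n| ^+ 2.
have a_incr : nondecreasing_seq a.
  by move=> m n /resolvent_path_gap gap; rewrite -subr_ge0; apply: le_trans gap; exact: sqr_ge0.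
have a_cvg : cvgn a.
  apply: nondecreasing_is_cvgn => //; exists (`|u - z| ^+ 2) => _ [n _ <-].
  exact: resolvent_path_bounded.
have aL n : a n <= limn a by exact: nondecreasing_cvgn_le.
have gap m n : (m <= n)%N -> `|path m - path n| ^+ 2 <= limn a - a m.
  by move=> /resolvent_path_gap; have := aL n; rewrite /a; lra.
apply/cvg_ex; apply: (@cauchy_sqr_cvgn _ _ _ (fun n => limn a - a n)).
  by rewrite -(subrr (limn a)); apply: cvgB => //; exact: cvg_cst.
move=> m n; have [mn|/ltnW nm] := leqP m n.
  by have := gap _ _ mn; have := aL n; lra.
by rewrite distrC; have := gap _ _ nm; have := aL m; lra.
Qed.

Lemma resolvent_path_limit_zero (p : H) : (fun n => path n) @ \oo --> p -> zeros T p.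
Proof.
move=> xp; apply: (maximal_monotone_related T_maxmon) => y eta Ty.
pose f n := dot (harmonic n *: (u - path n) - eta) (path n - y).
apply: (ler_cvgn (f := fun=> 0) (g := f)); first exact: cvg_cst.
- apply: (cvg_dot dot_norm); last by apply: cvgB => //; exact: cvg_cst.
  apply: cvgB; last exact: cvg_cst.
  rewrite -(scale0r (u - p)); apply: cvgZ; first exact: cvg_harmonic.
  by apply: cvgB => //; exact: cvg_cst.
- apply: nearW => n; apply: maximal_monotone_dot Ty => //.
  exact: (resolvent_graph dot_norm T_maxmon u (ltr0Sn R n)).
Qed.

(** A quantitative demiclosedness property. A point [y] of the domain with a small
    [xi] in [T y] nearly satisfies the obtuse angle condition that characterises
    [p] as the projection of [u]. It is proved at a point x = x_N of the path
    close to [p]: there (u - x) / (N + 1) belongs to [T x], so monotonicity gives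
    <u - x, y - x> <= (N + 1) <xi, y - x>. *)
Lemma resolvent_path_limit_variational (p : H) M eps : (fun n => path n) @ \oo --> p ->
  0 < eps -> 0 <= M ->
  exists2 C, 0 <= C & forall y xi, T y xi -> `|y - p| <= M ->
    dot (u - p) (y - p) <= eps + C * `|xi|.
Proof.
move=> xp eps0 M0.
pose K := `|u - p| + 1 + M.
have K0 : 0 < K by rewrite ltr_wpDr// ltr_wpDl.
(* Replacing p by x changes the inner product by at most d * K. *)
pose d := Num.min 1 (eps / K).
have d0 : 0 < d by rewrite lt_min ltr01 divr_gt0.
have d1 : d <= 1 by rewrite ge_min lexx.
have dK : d * K <= eps by rewrite -ler_pdivlMr// ge_min lexx orbT.
have /cvgrPdist_le/(_ _ d0)[N _ /(_ N (leqnn N))] := xp.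
set x := path N => /= px.
have N0 : 0 < N.+1%:R :> R by rewrite ltr0n.
exists (N.+1%:R * (M + 1)); first by rewrite mulr_ge0 ?addr_ge0.
move=> y xi Ty yM.
have h1 := resolvent_monotone dot_norm T_maxmon N0 u Ty.
have h2 := ler_dot_norm dot_norm (- xi) (x - y).
have xp1 : `|x - p| <= 1 by rewrite distrC (le_trans px).
have h3 : `|x - y| <= M + 1.
  by apply: le_trans (ler_distD p _ _) _; rewrite addrC lerD// distrC.
have h4 := ler_dot_norm dot_norm (u - x) (x - p).
have h5 : `|u - x| <= `|u - p| + 1.
  by apply: le_trans (ler_distD p _ _) _; rewrite lerD// distrC.
have h6 := ler_dot_norm dot_norm (x - p) (y - p).
have h7 : dot (u - x) (y - x) <= N.+1%:R * (M + 1) * `|xi|.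
  apply: (le_trans (y := N.+1%:R * dot (- xi) (x - y))).
    by move: h1; rewrite -(opprB y x) !dotNr dotNl; lra.
  rewrite -mulrA ler_pM2l//; apply: le_trans h2 _.
  by rewrite normrN mulrC ler_wpM2r.
have h8 : `|u - x| * `|x - p| <= (`|u - p| + 1) * d.
  by rewrite ler_pM// distrC.
have h9 : `|x - p| * `|y - p| <= d * M.
  by rewrite ler_pM// distrC.
have : dot (u - p) (y - p) = dot (u - x) (y - x) + dot (u - x) (x - p) + dot (x - p) (y - p).
  by rewrite !dotE; ring.
rewrite /K in dK *; lra.
Qed.

End ResolventPath.

(** * Scalar sequences *)

Section RealSequences.
Variable R : realType.
Implicit Types a alpha beta d : nat -> R.

(** Subtracting [eps] and the accumulated perturbations leaves a sequence that is
    multiplied by at most 1 - alpha n at each step. The product of these factors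
    vanishes because (1 - t) (1 + s + t) <= 1 + s bounds it by the inverse of
    1 + sum alpha. *)
Lemma halpern_recurrence_cvg0 a alpha d :
  (forall n, 0 <= a n) -> (forall n, 0 <= alpha n <= 1) ->
  (forall n, 0 <= d n) -> series alpha @ \oo --> +oo -> cvgn (series d) ->
  (forall eps, 0 < eps -> \forall n \near \oo,
     a n.+1 <= (1 - alpha n) * a n + alpha n * eps + d n) ->
  a @ \oo --> 0.
Proof.
move=> a0 alpha01 d0 alpha_sum d_cvg rec.
apply/cvgrPdist_le => eps eps0; pose e := eps / 3.
have e0 : 0 < e by rewrite divr_gt0.
have d_incr : nondecreasing_seq (series d) by apply: nondecreasing_series.
have [N1 _ recN] := rec _ e0.
have [N2 _ tailN] : \forall n \near \oo, limn (series d) - e < series d n.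
  by apply: cvgr_gt d_cvg _ _; rewrite gtrBl.
pose N := maxn N1 N2.
have dN n : series d n - series d N <= e.
  have := nondecreasing_cvgn_le d_incr d_cvg n.
  have := tailN N (leq_maxr _ _); rewrite /=; lra.
pose S n := series alpha n - series alpha N.
pose w n := a n - e - (series d n - series d N).
have Sw k : 0 <= S (N + k)%N /\ (1 + S (N + k)%N) * w (N + k)%N <= a N.
  elim: k => [|k [S0 IH]].
    by rewrite addn0 /S /w !subrr; split=> //; lra.
  set n := (N + k)%N in S0 IH *; rewrite addnS -/n.
  have SS : S n.+1 = S n + alpha n by rewrite /S seriesSr addrAC.
  have Nn : (N <= n)%N by exact: leq_addr.
  have := recN n (leq_trans (leq_maxl _ _) Nn).
  have /andP[al0 al1] := alpha01 n.
  have dn0 : 0 <= series d n - series d N by rewrite subr_ge0 d_incr.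
  rewrite SS => recn; split; first exact: addr_ge0.
  have wS : w n.+1 <= (1 - alpha n) * w n.
    have := mulr_ge0 al0 dn0; rewrite /w seriesSr; lra.
  have [w0|w0] := leP (w n) 0.
    apply: le_trans (a0 N); rewrite mulr_ge0_le0 ?(addr_ge0 _ (addr_ge0 _ _))//.
    by apply: le_trans wS _; rewrite mulr_ge0_le0// subr_ge0.
  apply: le_trans IH.
  apply: (@le_trans _ _ ((1 + (S n + alpha n)) * ((1 - alpha n) * w n))).
    by apply: ler_wpM2l wS; exact: addr_ge0 ler01 (addr_ge0 S0 al0).
  rewrite mulrA ler_pM2r//; have := mulr_ge0 S0 al0; have := mulr_ge0 al0 al0; lra.
have /cvgryPge/(_ (series alpha N + a N / e))[N3 _ bigS] := alpha_sum.
exists (maxn N N3) => // n /=; rewrite geq_max => /andP[Nn N3n].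
rewrite sub0r normrN ger0_norm//.
have := Sw (n - N)%N; rewrite subnKC// => -[Sn0 Swn].
have {bigS} : a N / e <= S n by rewrite /S lerBrDl; exact: bigS.
rewrite ler_pdivrMr// => aS.
have we : w n <= e.
  rewrite -(@ler_pM2l _ (1 + S n)) ?ltr_wpDr//.
  by apply: le_trans Swn _; rewrite mulrDl mul1r ler_wpDl// ltW.
have := dN n; move: we; rewrite /w /e; lra.
Qed.

Lemma limn_inf_sup_bound beta lo hi (A B : R) : (forall n, A < beta n < B) ->
  lo < limn_inf beta -> limn_sup beta < hi ->
  \forall n \near \oo, lo < beta n < hi.
Proof.
move=> AB lobeta betahi.
have lb : has_lbound (range beta).
  by exists A => _ [n _ <-]; case/andP: (AB n) => /ltW.
have ub : has_ubound (range beta).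
  by exists B => _ [n _ <-]; case/andP: (AB n) => _ /ltW.
have infsc : infs beta @ \oo --> limn_inf beta.
  exact: cvgP (cvg_infs_sup ub lb).
have supsc : sups beta @ \oo --> limn_sup beta.
  exact: cvgP (cvg_sups_inf ub lb).
near=> n.
have hinf : lo < infs beta n by near: n; exact: cvgr_gt infsc _ lobeta.
have hsup : sups beta n < hi by near: n; exact: cvgr_lt supsc _ betahi.
apply/andP; split.
  apply: lt_le_trans hinf _; apply: ge_inf; first exact: has_lbound_sdrop.
  by exists n => /=.
apply: le_lt_trans hsup; apply: ub_le_sup; first exact: has_ubound_sdrop.
by exists n => /=.
Unshelve. all: by end_near.
Qed.

End RealSequences.

(** * Projections *)

Section Projection.
Variables (R : realType) (H : completeNormedModType R).
Variable dot : {dot H for idfun}.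
Hypothesis dot_norm : induces_norm dot.

Lemma metric_proj_obtuse (S : set H) (u p : H) : S p ->
  (forall z, S z -> dot (u - p) (z - p) <= 0) -> metric_proj S u = p.
Proof.
move=> Sp obtuse.
have pythagoras z : S z -> `|u - p| ^+ 2 + `|p - z| ^+ 2 <= `|u - z| ^+ 2.
  move=> /obtuse; rewrite !dot_norm !dotE.
  by rewrite (dotC z u) (dotC p u) (dotC z p); lra.
have nearest_p : nearest_points S u p.
  split=> // z /pythagoras pz; rewrite -(@ler_pXn2r _ 2) ?nnegrE//.
  by apply: le_trans pz; rewrite lerDl sqr_ge0.
have [Sq qmin] : nearest_points S u (metric_proj S u).
  by apply: getPex; exists p.
have := pythagoras _ Sq; have := qmin _ Sp.
rewrite -(@ler_pXn2r _ 2) ?nnegrE// => le1 le2.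
have /eqP : `|p - metric_proj S u| ^+ 2 = 0.
  by apply/le_anti; rewrite sqr_ge0 andbT; lra.
by rewrite sqrf_eq0 normr_eq0 subr_eq0 => /eqP <-.
Qed.

End Projection.

(** * Halpern iteration of relaxed resolvents *)

Section Halpern.
Variables (R : realType) (H : completeNormedModType R).
Variable dot : {dot H for idfun}.
Hypothesis dot_norm : induces_norm dot.
Variable T : H -> set H.
Hypothesis T_maxmon : maximal_monotone dot T.
Variables (rho : R) (rho_gt0 : 0 < rho).
Variables (u0 p : H) (alpha beta : nat -> R).
Hypothesis Tp : zeros T p.
Hypothesis p_variational : forall M eps : R, 0 < eps -> 0 <= M ->
  exists2 C : R, 0 <= C & forall y xi, T y xi -> `|y - p| <= M ->
    dot (u0 - p) (y - p) <= eps + C * `|xi|.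
Hypothesis alpha01 : forall k, 0 < alpha k < 1.
Hypothesis alpha_cvg0 : alpha @ \oo --> 0.
Hypothesis alpha_sum : series alpha @ \oo --> +oo.
Hypothesis beta02 : forall k, 0 < beta k < 2.

Local Notation J := (resolvent rho T).
Local Notation G k := (relaxed_resolvent T rho (beta k)).

(** The iteration without inertia and without errors. *)
Fixpoint halpern (n : nat) : H :=
  if n is k.+1 then alpha k *: u0 + (1 - alpha k) *: G k (halpern k) else u0.

Lemma relaxed_resolvent_zero b : relaxed_resolvent T rho b p = p.
Proof.
rewrite /relaxed_resolvent (resolvent_zero dot_norm T_maxmon rho_gt0 Tp).
by rewrite -scalerDl subrK scale1r.
Qed.

Lemma relaxed_resolvent_dist k x y : `|G k x - G k y| <= `|x - y|.
Proof.
have /andP[b0 b2] := beta02 k.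
by apply: (relaxed_resolvent_nonexpansive dot_norm); rewrite // !ltW.
Qed.

Lemma halpern_bounded k : `|halpern k - p| <= `|u0 - p|.
Proof.
elim: k => [//|k IH] /=; have /andP[/ltW a0 /ltW a1] := alpha01 k.
have a1' : 0 <= 1 - alpha k by rewrite subr_ge0.
have -> : alpha k *: u0 + (1 - alpha k) *: G k (halpern k) - p =
    alpha k *: (u0 - p) + (1 - alpha k) *: (G k (halpern k) - G k p).
  by rewrite relaxed_resolvent_zero convex_subr.
apply: le_trans (ler_normD _ _) _; rewrite !normrZ !ger0_norm//.
have := ler_wpM2l a1' (le_trans (relaxed_resolvent_dist k _ _) IH); lra.
Qed.

Lemma resolvent_dist_zero x : `|J x - p| <= `|x - p|.
Proof.
have := resolvent_nonexpansive dot_norm T_maxmon rho_gt0 x p.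
by rewrite (resolvent_zero dot_norm T_maxmon rho_gt0 Tp).
Qed.

Local Notation M := `|u0 - p|.

(** Expanding the square of v' - p = alpha (u0 - p) + (1 - alpha) (G v - p)
    leaves the inner product <u0 - p, v' - p>. The next iterate v' lies within
    2 M alpha + s of y = J v, where s = |v - y|, and (v - y) / rho belongs to
    T y, so the variational property bounds the inner product by eps plus
    multiples of s and alpha. *)
Lemma halpern_step (eps C : R) k : 0 <= C ->
  (forall y xi, T y xi -> `|y - p| <= M ->
     dot (u0 - p) (y - p) <= eps + C * `|xi|) ->
  `|halpern k.+1 - p| ^+ 2 <=
    (1 - alpha k) * (`|halpern k - p| ^+ 2 -
      beta k * (2 - beta k) * `|halpern k - J (halpern k)| ^+ 2) +
    2 * alpha k * (eps + (C * rho^-1 + M) * `|halpern k - J (halpern k)| +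
      2 * M ^+ 2 * alpha k).
Proof.
move=> C0 variational; have /andP[/ltW a0 /ltW a1] := alpha01 k.
have /andP[/ltW b0 /ltW b2] := beta02 k.
have a1' : 0 <= 1 - alpha k by rewrite subr_ge0.
set v := halpern k; set y := J v; set s := `|v - y|; set v' := halpern k.+1.
have M0 : 0 <= M by [].
have vM : `|v - p| <= M by exact: halpern_bounded.
have yM : `|y - p| <= M by apply: le_trans vM; exact: resolvent_dist_zero.
have s0 : 0 <= s by exact: normr_ge0.
have dot_y : dot (u0 - p) (y - p) <= eps + C * rho^-1 * s.
  have := variational _ _ (resolvent_graph dot_norm T_maxmon v rho_gt0) yM.
  by rewrite normrZ gtr0_norm ?invr_gt0// mulrA.
have v'y : `|v' - y| <= 2 * M * alpha k + s.
  have -> : v' - y = alpha k *: (u0 - y) + ((1 - alpha k) * (1 - beta k)) *: (v - y).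
    rewrite /v' /= -/v convex_subr /relaxed_resolvent -/y.
    by rewrite [_ + beta k *: y]addrC convex_subr subrr scaler0 add0r scalerA.
  apply: le_trans (ler_normD _ _) _; rewrite !normrZ ?normrM (ger0_norm a0) (ger0_norm a1').
  have b1 : `|1 - beta k| <= 1 by rewrite ler_norml; apply/andP; split; lra.
  apply: lerD.
    rewrite mulrC ler_wpM2r//; apply: le_trans (ler_distD p _ _) _.
    by rewrite (distrC p) -/M; lra.
  by rewrite ler_piMl// mulr_ile1//; lra.
have dot_v' : dot (u0 - p) (v' - p) <=
    eps + (C * rho^-1 + M) * s + 2 * M ^+ 2 * alpha k.
  have -> : dot (u0 - p) (v' - p) = dot (u0 - p) (y - p) + dot (u0 - p) (v' - y).
    by rewrite !dotE; ring.
  have := ler_dot_norm dot_norm (u0 - p) (v' - y).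
  have := ler_wpM2l M0 v'y; lra.
have avg := relaxed_resolvent_averaged dot_norm T_maxmon rho_gt0 v p b0.
rewrite relaxed_resolvent_zero (resolvent_zero dot_norm T_maxmon rho_gt0 Tp) in avg.
rewrite subrr subr0 -/y -/s in avg.
have expand : `|v' - p| ^+ 2 <=
    (1 - alpha k) * `|G k v - p| ^+ 2 + 2 * alpha k * dot (u0 - p) (v' - p).
  have -> : v' - p = alpha k *: (u0 - p) + (1 - alpha k) *: (G k v - p).
    by rewrite /v' /= -/v convex_subr.
  have := dot_ge0 dot_norm (u0 - p); have := dot_ge0 dot_norm (G k v - p).
  move: (u0 - p) (G k v - p) => q h hh qq.
  rewrite !dot_norm !dotE (dotC h q).
  have := mulr_ge0 (mulr_ge0 a0 a0) qq.
  have := mulr_ge0 (mulr_ge0 a0 a1') hh; lra.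
apply: le_trans expand _; apply: lerD; first exact: ler_wpM2l.
by rewrite ler_wpM2l// mulr_ge0.
Qed.

(** In the estimate of one step the residual s occurs linearly with a factor
    alpha and quadratically with a negative constant factor. Completing the
    square turns the linear term into O(alpha^2), whatever the size of s, and
    O(alpha^2) is at most alpha eps for large k. *)
Lemma halpern_cvg (c : R) : 0 < c ->
  (\forall k \near \oo, c <= beta k * (2 - beta k)) -> halpern @ \oo --> p.
Proof.
move=> c0 beta_c.
suff sq0 : (fun k => `|halpern k - p| ^+ 2) @ \oo --> 0.
  apply/cvgrPdist_le => e e0.
  have e20 : 0 < e ^+ 2 by rewrite exprn_gt0.
  have /cvgrPdist_le/(_ _ e20) := sq0; apply: filterS => k.
  rewrite sub0r normrN ger0_norm ?sqr_ge0// distrC.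
  by rewrite ler_pXn2r ?nnegrE// ltW.
apply: (@halpern_recurrence_cvg0 _ _ alpha (fun=> 0)) => //.
- by move=> k; have /andP[/ltW -> /ltW ->] := alpha01 k.
- by apply: (cvgP 0); rewrite /series /=; under eq_fun do rewrite big1//; exact: cvg_cst.
move=> eps eps0; have eps40 : 0 < eps / 4 by rewrite divr_gt0.
have [C C0 variational] := p_variational eps40 (normr_ge0 (u0 - p)).
pose D := C * rho^-1 + M.
pose K := 2 * D ^+ 2 / c + 4 * M ^+ 2.
have K0 : 0 <= K by rewrite addr_ge0 ?divr_ge0 ?(ltW c0)// mulr_ge0 ?sqr_ge0.
near=> k.
have alpha_half : alpha k <= 2^-1.
  by near: k; apply: cvgr_le alpha_cvg0 _ _; rewrite invr_gt0.
have alphaK : alpha k * K <= eps / 2.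
  have : alpha k <= eps / 2 / (K + 1).
    near: k; apply: cvgr_le alpha_cvg0 _ _.
    by rewrite !divr_gt0// ltr_wpDl.
  rewrite ler_pdivlMr ?ltr_wpDl// mulrDr mulr1 => aK.
  by apply: le_trans aK; rewrite lerDl; case/andP: (alpha01 k) => /ltW.
have beta_k : c <= beta k * (2 - beta k) by near: k.
have /andP[/ltW a0 /ltW a1] := alpha01 k.
apply: le_trans (halpern_step k C0 variational) _.
rewrite -/D addr0; set s := `|halpern k - J _|.
have gain : c / 2 * s ^+ 2 <= (1 - alpha k) * (beta k * (2 - beta k) * s ^+ 2).
  rewrite [leRHS]mulrA ler_wpM2r ?sqr_ge0// mulrC.
  by apply: ler_pM; rewrite ?invr_ge0 ?(ltW c0)//; lra.
(* (c s - 2 alpha D)^2 >= 0 absorbs the linear term in s. *)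
have square : 2 * alpha k * (D * s) <= c / 2 * s ^+ 2 + alpha k ^+ 2 * (2 * D ^+ 2 / c).
  rewrite -subr_ge0.
  have -> : c / 2 * s ^+ 2 + alpha k ^+ 2 * (2 * D ^+ 2 / c) - 2 * alpha k * (D * s)
     = (c * s - 2 * alpha k * D) ^+ 2 / (2 * c) by field; rewrite gt_eqF.
  by rewrite divr_ge0 ?sqr_ge0// mulr_ge0// ltW.
have := ler_wpM2l a0 alphaK; rewrite /K; lra.
Unshelve. all: by end_near.
Qed.

(** Errors made inside the nonexpansive map are contracted by 1 - alpha, so
    summable errors do not change the limit. *)
Lemma halpern_perturbed (x : nat -> H) (d : nat -> R) : x 0%N = u0 ->
  (forall k, exists2 w, x k.+1 = alpha k *: u0 + (1 - alpha k) *: w &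
     `|w - G k (x k)| <= d k) ->
  cvgn (series d) -> halpern @ \oo --> p -> x @ \oo --> p.
Proof.
move=> x0 xS d_cvg; apply: cvg_sub0.
suff : (fun k => `|x k - halpern k|) @ \oo --> 0 by move/norm_cvg0P.
apply: (halpern_recurrence_cvg0 (alpha := alpha) (d := d)) => //.
- by move=> k; have /andP[/ltW -> /ltW ->] := alpha01 k.
- by move=> k; have [w _] := xS k; apply: le_trans.
move=> eps eps0; apply: nearW => k.
have [w -> wd] := xS k; have /andP[a0 a1] := alpha01 k.
rewrite /= opprD addrACA subrr add0r -scalerBr normrZ ger0_norm ?subr_ge0 ?(ltW a1)//.
have a1' : 0 <= 1 - alpha k by rewrite subr_ge0 ltW.
have h : `|w - G k (halpern k)| <= d k + `|x k - halpern k|.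
  apply: le_trans (ler_distD (G k (x k)) _ _) _.
  by apply: lerD => //; exact: relaxed_resolvent_dist.
have := ler_wpM2l a1' h.
have d0 : 0 <= d k by exact: le_trans wd.
have := mulr_ge0 (ltW a0) d0; have := mulr_ge0 (ltW a0) (ltW eps0); lra.
Qed.

End Halpern.

(** * Strong convergence of the inertial relaxed proximal iteration *)

(** The displacement produced by inertia and errors is bounded by the terms of
    the two summable series, using alpha_k < 1 for the first. *)
Theorem theorem3p4 (R : realType) (H : completeNormedModType R)
    (dot : {dot H for idfun}) (dot_norm : induces_norm dot)
    (T : H -> set H) (T_maxmon : maximal_monotone dot T)
    (zerosT : zeros T !=set0)
    (r : R) (r_gt0 : 0 < r)
    (um1 : H) (u uhat e : nat -> H) (alpha beta theta : nat -> R)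
    (uhatE : forall k, uhat k = u k + theta k *: (u k - prev um1 u k))
    (uE : forall k, u k.+1 =
       alpha k *: u 0%N +
       (1 - alpha k) *:
         ((1 - beta k) *: uhat k +
          beta k *: resolvent r^-1 T (uhat k - r^-1 *: e k)))
    (alpha01 : forall k, 0 < alpha k < 1)
    (alpha_cvg0 : alpha @ \oo --> 0)
    (alpha_sum : series alpha @ \oo --> +oo)
    (beta02 : forall k, 0 < beta k < 2)
    (beta_liminf_limsup : [/\ 0 < limn_inf beta,
       limn_inf beta <= limn_sup beta & limn_sup beta < 2])
    (theta01 : forall k, 0 <= theta k < 1)
    (theta_sum : cvgn (series
       (fun k => theta k / alpha k * `|u k - prev um1 u k|)))
    (e_sum : cvgn (series (fun k => `|e k|))) :
  u @ \oo --> metric_proj (zeros T) (u 0%N).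
Proof.
have rho0 : 0 < r^-1 by rewrite invr_gt0.
have [p xp] := resolvent_path_cvg dot_norm T_maxmon zerosT (u 0%N).
have Tp := resolvent_path_limit_zero dot_norm T_maxmon xp.
have variational M eps :=
  @resolvent_path_limit_variational _ _ _ dot_norm _ T_maxmon _ _ M eps xp.
have -> : metric_proj (zeros T) (u 0%N) = p.
  apply: (metric_proj_obtuse dot_norm Tp) => z Tz; apply/ler_addgt0Pl => eps eps0.
  have [C _ /(_ z 0 Tz (lexx _))] := variational _ _ eps0 (normr_ge0 (z - p)).
  by rewrite normr0 mulr0 !addr0.
have [c c0 beta_c] : exists2 c, 0 < c & \forall k \near \oo, c <= beta k * (2 - beta k).
  case: beta_liminf_limsup => inf0 _ sup2.
  pose lo := limn_inf beta / 2; pose hi := (limn_sup beta + 2) / 2.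
  have lo0 : 0 < lo by rewrite divr_gt0.
  have hi2 : hi < 2 by rewrite /hi; lra.
  exists (lo * (2 - hi)); first by rewrite mulr_gt0// subr_gt0.
  have : \forall k \near \oo, lo < beta k < hi.
    by apply: (limn_inf_sup_bound beta02); rewrite /lo /hi; lra.
  apply: filterS => k /andP[lok hik].
  by apply: ler_pM; rewrite ?(ltW lo0)//; lra.
pose d k := theta k / alpha k * `|u k - prev um1 u k| + 2 * r^-1 * `|e k|.
apply: (@halpern_perturbed _ _ _ dot_norm _ T_maxmon _ rho0 _ _ _ _ alpha01
  alpha_sum beta02 u d) => //; last first.
- exact: (halpern_cvg dot_norm T_maxmon rho0 Tp variational alpha01 alpha_cvg0
    alpha_sum beta02 c0 beta_c).
- have e2_sum := is_cvg_seriesZ (k := 2 * r^-1) e_sum.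
  exact: is_cvg_seriesD theta_sum e2_sum.
move=> k; have /andP[a0 a1] := alpha01 k; have /andP[t0 _] := theta01 k.
have /andP[b0 b2] := beta02 k.
exists ((1 - beta k) *: uhat k + beta k *: resolvent r^-1 T (uhat k - r^-1 *: e k)).
  exact: uE.
pose G := relaxed_resolvent T r^-1 (beta k).
apply: le_trans; first exact: (ler_distD (G (uhat k))).
rewrite addrC; apply: lerD.
  apply: le_trans (relaxed_resolvent_dist dot_norm T_maxmon rho0 beta02 k _ _) _.
  rewrite uhatE addrC addKr normrZ ger0_norm// ler_wpM2r// ler_peMr//.
  by rewrite invf_ge1// ltW.
rewrite /G /relaxed_resolvent opprD addrACA subrr add0r -scalerBr normrZ gtr0_norm//.
rewrite -mulrA; apply: ler_pM; rewrite ?(ltW b0) ?(ltW b2)//.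
apply: le_trans (resolvent_nonexpansive dot_norm T_maxmon rho0 _ _) _.
by rewrite addrAC subrr add0r normrN normrZ gtr0_norm.
Qed.
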